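(* Let $q:F\twoheadrightarrow\mathbb Z$ be a surjective group homomorphism, let $S$ be a numerical monoid, and let $M_S=\mathcal P_{\mathrm{fin},0}(S)$. Then the following statements hold. (1) The map $\rho_q:M_S\to\mathcal P_+(F)$, $\rho_q(A):=q^{-1}(A)$, is an injective semigroup homomorphism. (2) Conjugation by $\rho_q$, i.e. $\varphi\mapsto\rho_q\circ\varphi\circ\rho_q^{-1}$, induces an isomorphism of groups $\mathrm{Aut}(M_S)\to\mathrm{Aut}(\rho_q(M_S))$. (3) For all $A,B,X\in M_S$, $A\star X=B\star X$ if and only if $\rho_q(A)\star\rho_q(X)=\rho_q(B)\star\rho_q(X)$.
   Context: A numerical monoid is an additive submonoid $S$ of $\mathbb N=\{0,1,2,\ldots\}$ with $\mathbb N\setminus S$ finite. $\mathcal P_{\mathrm{fin},0}(S)=\{A\subseteq S: A\text{ finite},\ 0\in A\}$, with multiplication the sumset $A\star B=\{a+b:a\in A,b\in B\}$. For a group $F$ (written multiplicatively), $\mathcal P_+(F)$ is the set of non-empty subsets of $F$ with multiplication $A\star B=\{ab:a\in A,b\in B\}$. For $A\subseteq S\subseteq\mathbb Z$, $q^{-1}(A)=\{x\in F:q(x)\in A\}$. $\mathrm{Aut}$ denotes the group of semigroup automorphisms; $\rho_q(M_S)$ is the image of $\rho_q$, and $\rho_q^{-1}$ denotes the inverse of the bijection $\rho_q:M_S\to\rho_q(M_S)$. *)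

(* Defs.v *)
From HB Require Import structures.
From mathcomp Require Import all_boot all_order all_algebra.
From mathcomp Require Import all_classical.

Set Implicit Arguments.
Unset Strict Implicit.
Unset Printing Implicit Defensive.

Local Open Scope classical_set_scope.
Local Open Scope group_scope.

Section FinitarySubsets.
Variable S : {pred nat}.

Definition is_Pfin0 (A : set nat) : bool :=
  `[< [/\ A `<=` [set` S], finite_set A & A 0%N] >].

Record Pfin0 : Type := MkPfin0 { Pfin0_val :> set nat; _ : is_Pfin0 Pfin0_val }.

HB.instance Definition _ := [isSub for Pfin0_val].
HB.instance Definition _ := [Choice of Pfin0 by <:].

End FinitarySubsets.

Section FinitarySubsetsSemigroup.
Variable S : addrClosed nat.

Lemma is_Pfin0_sumset (A B : Pfin0 S) :
  is_Pfin0 S [set (a + b)%N | a in A & b in B].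
Proof.
case: A B => [A /asboolP[AS fA A0]] [B /asboolP[BS fB B0]] /=.
apply/asboolP; split=> /=; last by exists 0%N => //; exists 0%N.
- move=> _ [a Aa [b Bb <-]] /=.
  by apply: (@GRing.rpredD _ S a b); [exact: AS | exact: BS].
- exact: finite_image2.
Qed.

Definition Pfin0_mul (A B : Pfin0 S) : Pfin0 S := MkPfin0 (is_Pfin0_sumset A B).

Lemma Pfin0_mulA : associative Pfin0_mul.
Proof.
move=> A B C; apply/val_inj/seteqP; split=> /= z.
- move=> [a Aa [y [b Bb [c Cc <-]] <-]].
  by exists (a + b)%N; [exists a => //; exists b | exists c => //; rewrite addnA].
- move=> [y [a Aa [b Bb <-]] [c Cc <-]].
  by exists a => //; exists (b + c)%N; [exists b => //; exists c | rewrite addnA].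
Qed.

HB.instance Definition _ := isSemigroup.Build (Pfin0 S) Pfin0_mulA.

End FinitarySubsetsSemigroup.

Section NonemptySubsets.
Variable F : semigroupType.

Definition is_Pplus (A : set F) : bool := `[< A !=set0 >].

Record Pplus : Type := MkPplus { Pplus_val :> set F; _ : is_Pplus Pplus_val }.

HB.instance Definition _ := [isSub for Pplus_val].
HB.instance Definition _ := [Choice of Pplus by <:].

Lemma is_Pplus_prodset (A B : Pplus) : is_Pplus [set a * b | a in A & b in B].
Proof.
case: A B => [A /asboolP[a Aa]] [B /asboolP[b Bb]] /=.
by apply/asboolP; exists (a * b), a => //; exists b.
Qed.

Definition Pplus_mul (A B : Pplus) : Pplus := MkPplus (is_Pplus_prodset A B).

Lemma Pplus_mulA : associative Pplus_mul.
Proof.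
move=> A B C; apply/val_inj/seteqP; split=> /= z.
- move=> [a Aa [y [b Bb [c Cc <-]] <-]].
  by exists (a * b); [exists a => //; exists b | exists c => //; rewrite mulgA].
- move=> [y [a Aa [b Bb <-]] [c Cc <-]].
  by exists a => //; exists (b * c); [exists b => //; exists c | rewrite mulgA].
Qed.

HB.instance Definition _ := isSemigroup.Build Pplus Pplus_mulA.

End NonemptySubsets.

Section Image.
Variables (M N : semigroupType) (f : {multiplicative M -> N}).

Definition in_image (y : N) : bool := `[< range f y >].

Record image_semigroup : Type :=
  MkImage { image_val :> N; _ : in_image image_val }.

HB.instance Definition _ := [isSub for image_val].
HB.instance Definition _ := [Choice of image_semigroup by <:].

Lemma in_image_mul : mulg_closed in_image.
Proof.
move=> _ _ /asboolP[x _ <-] /asboolP[y _ <-].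
by apply/asboolP; exists (x * y) => //; rewrite gmulfM.
Qed.

HB.instance Definition _ :=
  SubChoice_isSubSemigroup.Build N in_image image_semigroup in_image_mul.

Lemma in_image_apply (x : M) : in_image (f x).
Proof. by apply/asboolP; exists x. Qed.

Definition to_image (x : M) : image_semigroup := MkImage (in_image_apply x).

Lemma to_image_surj (y : image_semigroup) : exists x : M, to_image x = y.
Proof.
by case: y => y ly; case/asboolP: (ly) => x _ fx; exists x; apply: val_inj.
Qed.

(* A section of [to_image]; it is its two-sided inverse when f is injective. *)
Definition of_image (y : image_semigroup) : M := projT1 (cid (to_image_surj y)).

End Image.

Arguments to_image {M N} f x.
Arguments of_image {M N} f y.

Section SemigroupAutomorphisms.
Variable M : semigroupType.

Definition is_saut (f : M -> M) : bool :=
  `[< bijective f /\ {morph f : x y / x * y} >].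

Record saut : Type := MkSaut { saut_val :> M -> M; _ : is_saut saut_val }.

HB.instance Definition _ := [isSub for saut_val].
HB.instance Definition _ := [Choice of saut by <:].

Lemma is_saut_id : is_saut id.
Proof. by apply/asboolP; split=> //; exists id. Qed.

Lemma is_saut_comp (f g : saut) : is_saut (f \o g).
Proof.
case: f g => [f /asboolP[fb fM]] [g /asboolP[gb gM]] /=.
by apply/asboolP; split; [exact: bij_comp | move=> x y /=; rewrite gM fM].
Qed.

Lemma saut_inv_ex (f : saut) :
  exists g : M -> M, [/\ cancel f g, cancel g f & is_saut g].
Proof.
case: f => f /= /asboolP[[g fK gK] fM]; exists g; split=> //.
apply/asboolP; split; first by exists f.
by move=> x y; apply: (can_inj fK); rewrite fM !gK.
Qed.

Definition saut_one : saut := MkSaut is_saut_id.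
Definition saut_mul (f g : saut) : saut := MkSaut (is_saut_comp f g).
Definition saut_inv (f : saut) : saut :=
  let: exist _ (And3 _ _ gA) := cid (saut_inv_ex f) in MkSaut gA.

Lemma saut_mulA : associative saut_mul.
Proof. by move=> f g h; apply: val_inj. Qed.

Lemma saut_mul1 : left_id saut_one saut_mul.
Proof. by move=> f; apply: val_inj. Qed.

Lemma saut_mulr1 : right_id saut_one saut_mul.
Proof. by move=> f; apply: val_inj. Qed.

Lemma saut_mulV : left_inverse saut_one saut_inv saut_mul.
Proof.
move=> f; apply: val_inj; rewrite /saut_inv.
by case: cid => g [fK gK gA] /=; apply/funext => x /=; rewrite fK.
Qed.

Lemma saut_mulrV : right_inverse saut_one saut_inv saut_mul.
Proof.
move=> f; apply: val_inj; rewrite /saut_inv.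
by case: cid => g [fK gK gA] /=; apply/funext => x /=; rewrite gK.
Qed.

HB.instance Definition _ :=
  isGroup.Build saut saut_mulA saut_mul1 saut_mulr1 saut_mulV saut_mulrV.

End SemigroupAutomorphisms.

(* Main.v *)
(* Sets of the form q^-1(A) multiply like sets of integers: if q x = a + b,
   choose u with q u = a by surjectivity; then x = u (u^-1 x) with
   q (u^-1 x) = b. Surjectivity also recovers A from q^-1(A). *)

Require Import Defs.
From HB Require Import structures.
From mathcomp Require Import all_boot all_order all_algebra.
From mathcomp Require Import all_classical.

Local Open Scope classical_set_scope.
Local Open Scope group_scope.

Section ConjugationByEmbedding.
Variables (M N : semigroupType) (f : {multiplicative M -> N}).
Hypothesis f_inj : injective f.

Lemma of_imageK : cancel (of_image f) (to_image f).
Proof. by move=> y; rewrite /of_image; case: cid. Qed.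

(** Injectivity of [f] enters here: [of_imageK] at [to_image f x] only tells that the chosen
    preimage and [x] have the same value under [f]. *)
Lemma to_imageK : cancel (to_image f) (of_image f).
Proof.
by move=> x; apply: f_inj; have /(congr1 val) := of_imageK (to_image f x).
Qed.

Lemma to_imageM : {morph to_image f : x y / x * y}.
Proof. by move=> x y; apply: val_inj; rewrite /= gmulfM. Qed.

Lemma of_imageM : {morph of_image f : x y / x * y}.
Proof.
move=> x y; apply: (can_inj to_imageK).
by rewrite to_imageM !of_imageK.
Qed.

(** [to_image f] and [of_image f] are mutually inverse isomorphisms, so all three factors are
    bijective and multiplicative. *)
Lemma is_saut_conj_image (phi : saut M) :
  is_saut (to_image f \o phi \o of_image f).
Proof.
case: phi => phi /= /asboolP[phi_bij phiM]; apply/asboolP; split.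
  apply: bij_comp; last by exists (to_image f); [exact: of_imageK|exact: to_imageK].
  by apply: bij_comp => //; exists (of_image f); [exact: to_imageK|exact: of_imageK].
by move=> x y /=; rewrite of_imageM phiM to_imageM.
Qed.

Definition conj_image (phi : saut M) : saut (image_semigroup f) :=
  MkSaut (is_saut_conj_image phi).

(** In a product of two conjugates, the inner [of_image f] meets [to_image f] and cancels. *)
Lemma conj_imageM : {morph conj_image : phi psi / phi * psi}.
Proof.
by move=> phi psi; apply/val_inj/funext => y /=; rewrite to_imageK.
Qed.

(** Conjugation in the opposite direction, which serves as the inverse of [conj_image]. *)
Lemma is_saut_conj_of_image (psi : saut (image_semigroup f)) :
  is_saut (of_image f \o psi \o to_image f).
Proof.
case: psi => psi /= /asboolP[psi_bij psiM]; apply/asboolP; split.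
  apply: bij_comp; last by exists (of_image f); [exact: to_imageK|exact: of_imageK].
  by apply: bij_comp => //; exists (to_image f); [exact: of_imageK|exact: to_imageK].
by move=> x y /=; rewrite to_imageM psiM of_imageM.
Qed.

Lemma conj_image_bij : bijective conj_image.
Proof.
exists (fun psi => MkSaut (is_saut_conj_of_image psi)) => phi;
  apply/val_inj/funext => x /=.
- by rewrite !to_imageK.
- by rewrite !of_imageK.
Qed.

End ConjugationByEmbedding.

Section Preimage.
Variables (F : groupType) (q : F -> int).
Hypothesis q_hom : {morph q : x y / x * y >-> (x + y)%R}.
Hypothesis q_surj : forall z : int, exists x : F, q x = z.
Variable S : addrClosed nat.

Lemma is_Pplus_preimage (A : Pfin0 S) : is_Pplus (q @^-1` (Posz @` A)).
Proof.
case: A => A /= /asboolP[_ _ A0]; apply/asboolP.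
(* Since [A] contains 0, any element of the kernel of [q] is a witness. *)
by have [x qx] := q_surj 0%R; exists x; exists 0%N.
Qed.

Definition Pfin0_preimage (A : Pfin0 S) : Pplus F :=
  MkPplus (is_Pplus_preimage A).

Lemma Pfin0_preimageM : {morph Pfin0_preimage : A B / A * B}.
Proof.
move=> A B; apply/val_inj/seteqP; split=> /= x.
- move=> [_ [a Aa [b Bb <-]] qx]; have [u qu] := q_surj a.
  exists u; first by exists a.
  exists (u^-1 * x); last by rewrite mulVKg.
  (* Adding [q u] on both sides turns the claim into [q u + b = q x], so the value of [q] at an
     inverse is never computed. *)
  exists b => //; apply: (@GRing.addrI _ (q u)).
  by rewrite -q_hom mulVKg -qx qu PoszD.
- move=> [u [a Aa qu] [v [b Bb qv] <-]].
  by exists (a + b)%N; [exists a => //; exists b | rewrite q_hom -qu -qv PoszD].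
Qed.

Lemma Pfin0_preimage_inj : injective Pfin0_preimage.
Proof.
(* One inclusion suffices, by symmetry. A point [x] over [a] lies in both preimages, so [q x] is
   also some [b] in [B], and [b = a] because [Posz] is injective. *)
have sub A B : Pfin0_preimage A = Pfin0_preimage B -> A `<=` B.
  move=> /(congr1 val) /= eqAB a Aa; have [x qx] := q_surj a.
  have : (q @^-1` (Posz @` A)) x by exists a.
  by rewrite eqAB => -[b Bb]; rewrite qx => -[<-].
by move=> A B eqAB; apply/val_inj/seteqP; split; apply: sub.
Qed.

End Preimage.

Theorem theorem5 (F : groupType) (q : F -> int)
    (q_hom : {morph q : x y / x * y >-> (x + y)%R})
    (q_surj : forall z : int, exists x : F, q x = z)
    (S : addrClosed nat) (S_cofinite : finite_set [set n : nat | n \notin S]) :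
  exists rho : {multiplicative Pfin0 S -> Pplus F},
    [/\ forall A : Pfin0 S, rho A = q @^-1` (Posz @` A) :> set F,
        injective rho,
        exists Phi : {multiplicative saut (Pfin0 S) -> saut (image_semigroup rho)},
          (forall phi : saut (Pfin0 S),
             Phi phi = to_image rho \o phi \o of_image rho
               :> (image_semigroup rho -> image_semigroup rho)) /\
          bijective Phi
      & forall A B X : Pfin0 S,
          A * X = B * X <-> rho A * rho X = rho B * rho X].
Proof.
pose rhoM := isMultiplicative.Build _ _ _ (Pfin0_preimageM _ _ q_hom q_surj S).
pose rho : {multiplicative Pfin0 S -> Pplus F} :=
  HB.pack (Pfin0_preimage F q q_surj S) rhoM.
have rho_inj : injective rho by exact: Pfin0_preimage_inj.
exists rho; split=> //.
- pose PhiM := isMultiplicative.Build _ _ _ (conj_imageM _ _ rho rho_inj).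
  pose Phi : {multiplicative saut (Pfin0 S) -> saut (image_semigroup rho)} :=
    HB.pack (conj_image _ _ rho rho_inj) PhiM.
  by exists Phi; split=> //; apply: conj_image_bij.
(* Both right-hand products are values of [rho] at products in [Pfin0 S], so the converse is
   injectivity of [rho]. *)
- by move=> A B X; rewrite -!gmulfM; split=> [->|/rho_inj].
Qed.
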